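(* A real number $\alpha>1$ has a purely periodic OCF expansion if and only if $\alpha$ is a quadratic surd with $-G<\bar\alpha<2-G$, where $\bar\alpha$ denotes the conjugate of $\alpha$. Furthermore, if $$\alpha=[\![\,\overline{(a_1,\epsilon_1);(a_2,\epsilon_2),\ldots,(a_r,\epsilon_r)}\,]\!]_o,$$ then $$\bar\alpha=-\langle\!\langle\,\overline{(a_r,\epsilon_r),\ldots,(a_1,\epsilon_1)}\,\rangle\!\rangle_o .$$
   Context: Let $G=\tfrac12(\sqrt5+1)$. Odd continued fractions (OCF): every irrational $x\in[0,1]$ has a unique expansion $$x=[\![(a_1,\epsilon_1),(a_2,\epsilon_2),\ldots]\!]_o=\cfrac{1}{a_1+\cfrac{\epsilon_1}{a_2+\cfrac{\epsilon_2}{a_3+\cdots}}}$$ with $\epsilon_i\in\{\pm1\}$, $a_i$ odd positive integers, $a_i+\epsilon_i\ge2$. For irrational $\alpha>1$ the OCF expansion is $$\alpha=[\![(a_1,\epsilon_1);(a_2,\epsilon_2),\ldots]\!]_o:=a_1+\epsilon_1[\![(a_2,\epsilon_2),(a_3,\epsilon_3),\ldots]\!]_o$$ with the same digit restrictions. Grotesque continued fractions (GCF): for $\epsilon_i\in\{\pm1\}$ and odd positive integers $b_i$ with $b_i+\epsilon_i\ge2$, $$\langle\!\langle(b_0,\epsilon_0),(b_1,\epsilon_1),(b_2,\epsilon_2),\ldots\rangle\!\rangle_o=\cfrac{\epsilon_0}{b_0+\cfrac{\epsilon_1}{b_1+\cfrac{\epsilon_2}{b_2+\cdots}}};$$ these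 are used to represent the irrationals in $I_G=(G-2,G)$. An overline means that the block of digits is repeated periodically forever (purely periodic expansion). A quadratic surd is a real irrational root of a quadratic polynomial with integer coefficients; its conjugate is the other root.
   Formalization: The upper bound on the conjugate is non-strict, ᾱ ≤ 2−G instead of ᾱ < 2−G: the strict form fails for α = G+1, which is purely periodic with the single digit (3,−1) and has ᾱ = 2−G; for every other α > 1 the two conditions agree. *)

(* Defs.v *)
From HB Require Import structures.
From mathcomp Require Import all_boot all_order all_algebra.
From mathcomp Require Import all_classical all_reals all_analysis.

Set Implicit Arguments.
Unset Strict Implicit.
Unset Printing Implicit Defensive.

Import Order.TTheory GRing.Theory Num.Theory.
Import numFieldNormedType.Exports.

Local Open Scope classical_set_scope.
Local Open Scope ring_scope.

Definition golden (R : realType) : R := (Num.sqrt 5 + 1) / 2.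

(* A digit is a pair (a, e) of an odd (hence positive) a and e = 1 or -1. *)
Definition digit : Type := (nat * int)%type.

Definition admissible (d : digit) : bool :=
  [&& odd d.1, (d.2 == 1) || (d.2 == -1) & 2 <= d.1%:Z + d.2].

Definition digits_tail (d : nat -> digit) : nat -> digit := fun i => d i.+1.

(* 1 / (a_0 + e_0 / (a_1 + e_1 / (... + e_(n-2) / a_(n-1)))); on admissible
   digits no denominator vanishes. *)
Fixpoint ocf_trunc (R : realType) (d : nat -> digit) (n : nat) : R :=
  if n is m.+1 then
    1 / ((d 0%N).1%:R + (d 0%N).2%:~R * ocf_trunc R (digits_tail d) m)
  else 0.

(* e_0 / (b_0 + e_1 / (b_1 + ... + e_(n-1) / b_(n-1))); on admissible digits
   no denominator vanishes. *)
Fixpoint gcf_trunc (R : realType) (d : nat -> digit) (n : nat) : R :=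
  if n is m.+1 then
    (d 0%N).2%:~R / ((d 0%N).1%:R + gcf_trunc R (digits_tail d) m)
  else 0.

(* x = a_0 + e_0 [[ d_1, d_2, ... ]], the infinite fraction being the limit of
   its truncations. *)
Definition ocf_expansion (R : realType) (x : R) (d : nat -> digit) : Prop :=
  (forall i, admissible (d i)) /\
  ((d 0%N).1%:R + (d 0%N).2%:~R * ocf_trunc R (digits_tail d) n : R)
    @[n --> \oo] --> x.

(* x = << d_0, d_1, d_2, ... >> *)
Definition gcf_expansion (R : realType) (x : R) (d : nat -> digit) : Prop :=
  (forall i, admissible (d i)) /\ gcf_trunc R d n @[n --> \oo] --> x.

(* The stream s s s ..., meaningful for s != [::]. *)
Definition periodic_digits (s : seq digit) : nat -> digit :=
  fun i => nth (0%N, 0) s (i %% size s).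

Definition purely_periodic_ocf (R : realType) (x : R) : Prop :=
  exists s : seq digit, s != [::] /\ ocf_expansion x (periodic_digits s).

Definition int_quadratic_root (R : realType) (p : {poly int}) (x : R) : Prop :=
  size p = 3%N /\ root (map_poly intr p) x.

Definition quadratic_surd (R : realType) (x : R) : Prop :=
  irrational x /\ exists p : {poly int}, int_quadratic_root p x.

(* An irrational root of an integral quadratic is a simple root, and the
   polynomial is unique up to a scalar, so for a quadratic surd x exactly one y
   qualifies; otherwise the value is not meaningful. *)
Definition conjugate (R : realType) (x : R) : R :=
  xget 0 [set y | y <> x /\ exists p : {poly int},
    int_quadratic_root p x /\ int_quadratic_root p y].

(* Main.v *)
Require Import Defs.
From HB Require Import structures.
From mathcomp Require Import all_boot all_order all_algebra.
From mathcomp Require Import all_classical all_reals all_analysis.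
From mathcomp Require Import ring lra zify.

(** An odd continued fraction step sends x to x' = e / (x - a), that is,
    x = a + e / x'. Being a Moebius map with integral coefficients, it sends a
    pair of conjugate surds to a pair of conjugate surds; so one follows the
    pair (x, y), where y is the conjugate of x. In terms of u = - y the step
    reads u' = e / (a + u), which is one step of a grotesque continued fraction
    read backwards. The two halves of a pair thus live in different expansions:
    x > 1 produces the digits, and u in [G - 2, G] (with G the golden ratio)
    remembers them.

    Pure periodicity gives the bounds. A number is (A x + B) / (C x + D), where x
    is what remains after a block of digits is removed and 0 < C <= A
    (convergent_matrix), so a periodic alpha is a root of the quadratic
    C t^2 + (D - A) t - B. It is irrational by descent (ocf_irrational).
    Removing the block maps [- G, 2 - G] into itself (golden_complete_quotient),
    hence the quadratic has opposite signs, or vanishes, at the ends of this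
    interval; alpha > 1 is outside, so the conjugate y is inside, and removing
    the block fixes it. The successive images of - y are then the
    tails of a periodic grotesque fraction whose digits come in reverse order,
    and this fraction converges to - y because two consecutive steps contract
    (gcf_expansion_of_chain). The end - G itself is excluded because its
    own conjugate is smaller than 1 (conj_neq_Ngolden).

    Conversely, call (x, y) reduced when x > 1 is irrational and
    - G < y <= 2 - G. Steps preserve reduced pairs (reduced_gauss) and the
    discriminant of their integral equation, and only finitely many integral
    equations of given discriminant have a reduced pair of roots
    (reduced_bounded); hence the orbit of (alpha, conjugate alpha) takes some
    value twice. For distinct digits the images of ]- G, 2 - G] are disjoint
    (gauss_conj_inj), so y' determines the digit that produced it and the step
    is injective on reduced pairs. Going back from the repetition, the orbit
    returns to its starting point, which is pure periodicity. *)

Set Implicit Arguments.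
Unset Strict Implicit.
Unset Printing Implicit Defensive.

Import Order.TTheory GRing.Theory Num.Theory.
Import numFieldNormedType.Exports.

Local Open Scope classical_set_scope.
Local Open Scope ring_scope.

(** * Digits and the golden ratio *)

(** The numerical bounds and the quadratic equation of the golden ratio are all
    that later inequalities need to know of it. *)
Lemma golden_spec (R : realType) :
  golden R ^+ 2 = golden R + 1 /\ 3 / 2 < golden R < 2.
Proof.
have s5 : Num.sqrt 5 ^+ 2 = 5 :> R by rewrite sqr_sqrtr.
have s0 : 0 <= Num.sqrt 5 :> R by exact: sqrtr_ge0.
by rewrite /golden; split; [lra|apply/andP; split; nra].
Qed.

Lemma admissible_cases (R : realType) (d : digit) : admissible d ->
  (d.1%:R = 1 :> R /\ d.2%:~R = 1 :> R) \/
  (3 <= d.1%:R :> R /\ (d.2%:~R = 1 :> R \/ d.2%:~R = -1 :> R)).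
Proof.
case: d => a e /and3P[/= oa /orP[]/eqP -> ha].
  case: (leqP 3 a) => a3; first by right; rewrite ler_nat; split=> //; left.
  by left; have -> : a = 1%N by lia.
right; rewrite (ler_nat R 3); split; last by right; rewrite mulrNz.
by lia.
Qed.

Lemma admissible_bounds (R : realType) (d : digit) : admissible d ->
  [/\ 1 <= d.1%:R :> R, 2 <= d.1%:R + d.2%:~R :> R
    & d.2%:~R = 1 :> R \/ d.2%:~R = -1 :> R].
Proof.
by move=> /(admissible_cases R)[[-> ->]|[a3 [->|->]]]; split; lra || by [left|right].
Qed.

Lemma sign_sqr (R : realType) (d : digit) :
  admissible d -> d.2%:~R ^+ 2 = 1 :> R.
Proof.
by move=> /(admissible_bounds R)[_ _ [->|->]]; rewrite ?sqrrN expr1n.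
Qed.

(** Digits are odd, so a distance less than 2 already identifies them. *)
Lemma digit_inj (R : realType) (d d' : digit) : admissible d -> admissible d' ->
  d.2%:~R = d'.2%:~R :> R -> `|d.1%:R - d'.1%:R : R| < 2 -> d = d'.
Proof.
case: d d' => [a e] [a' e'] /and3P[/= oa _ _] /and3P[/= oa' _ _].
move=> /intr_inj ->; rewrite ltr_norml => /andP[h1 h2].
have : a%:R < (a' + 2)%:R :> R by rewrite natrD; lra.
have : a'%:R < (a + 2)%:R :> R by rewrite natrD; lra.
by rewrite !ltr_nat => h3 h4; congr pair; lia.
Qed.

(** * The step x = a + e / x' *)

(** The Gauss map on the branch of the digit d; the digit is a parameter because
    the same branch is applied to a number and to its conjugate. *)
Definition gauss (R : realType) (d : digit) (x : R) : R :=
  d.2%:~R / (x - d.1%:R).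

Lemma gauss_rel (R : realType) (d : digit) (x : R) :
  x != d.1%:R -> x * gauss d x = d.1%:R * gauss d x + d.2%:~R.
Proof. by rewrite -subr_eq0 /gauss => xa; field. Qed.

Lemma gauss_inj (R : realType) (d : digit) (x x' : R) :
  admissible d -> gauss d x = gauss d x' -> x = x'.
Proof.
move=> ad; have [_ _ e1] := admissible_bounds R ad.
have e0 : d.2%:~R != 0 :> R by case: e1 => ->; rewrite ?oppr_eq0 oner_neq0.
by move=> /(mulfI e0)/invr_inj/addIr.
Qed.

(** * Irrational numbers *)

Lemma irrationalP (R : realType) (x : R) :
  irrational x <-> forall p q : int, p%:~R * x + q%:~R = 0 -> p = 0.
Proof.
split=> [xI p q pq|xI [r _ rx]].
  apply: contrapT => /eqP p0; apply: xI; exists (- q%:~R / p%:~R) => //.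
  rewrite fmorph_div rmorphN /= !ratr_int.
  have : p%:~R != 0 :> R by rewrite intr_eq0.
  move=> pN0; have -> : q%:~R = - (p%:~R * x) by apply/eqP; rewrite -addr_eq0 addrC pq.
  by field.
have := xI (denq r) (- numq r); rewrite -rx.
have -> : (denq r)%:~R * ratr r + (- numq r)%:~R = 0 :> R.
  rewrite -(ratr_int R (denq r)) -(ratr_int R (- _)) -rmorphM -rmorphD/=.
  by rewrite mulrC -numqE mulrNz subrr rmorph0.
by move=> /(_ erefl)/eqP; rewrite (negbTE (denq_neq0 r)).
Qed.

Lemma irrational_neq_nat (R : realType) (x : R) (n : nat) :
  irrational x -> x <> n%:R.
Proof.
move=> /irrationalP/(_ 1 (- n%:Z)); rewrite mulrNz mul1r => h xn.
by have := h; rewrite xn subrr => /(_ erefl).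
Qed.

Lemma gauss_irrational (R : realType) (d : digit) (x : R) :
  admissible d -> irrational x -> irrational (gauss d x).
Proof.
move=> ad xI; have xa : x - d.1%:R != 0.
  by rewrite subr_eq0; apply/eqP/irrational_neq_nat.
have e1 := sign_sqr R ad.
have e0 : d.2 != 0.
  by apply: contra_eq_neq e1 => ->; rewrite expr0n eq_sym oner_neq0.
apply/irrationalP => p q pq.
have rel : q%:~R * x + (p * d.2 - q * d.1%:Z)%:~R = 0 :> R.
  transitivity ((p%:~R * gauss d x + q%:~R) * (x - d.1%:R)).
    by rewrite /gauss !(intrD, intrM, mulrNz) -[d.1%:R]/(d.1%:Z%:~R); field.
  by rewrite pq mul0r.
have q0 : q = 0 by move/irrationalP: xI; apply; exact: rel.
move: rel; rewrite q0 !mul0r add0r subr0 => /eqP.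
by rewrite intr_eq0 mulf_eq0 (negbTE e0) orbF => /eqP.
Qed.

(** * Conjugate quadratic surds *)

Lemma int_quadratic_rootE (R : realType) (p : {poly int}) (x : R) :
  int_quadratic_root p x <->
  size p = 3%N /\ (p`_2)%:~R * x ^+ 2 + (p`_1)%:~R * x + (p`_0)%:~R = 0.
Proof.
split=> -[sp px]; split=> //; move: px.
  have /(horner_coef_wide x) : (size (map_poly intr p : {poly R}) <= 3)%N.
    by rewrite -sp size_poly.
  move=> hE /rootP; rewrite hE !big_ord_recr big_ord0/= !coef_map/=.
  by rewrite expr0 expr1 => <-; ring.
move=> px; apply/rootP.
have /(horner_coef_wide x) -> : (size (map_poly intr p : {poly R}) <= 3)%N.
  by rewrite -sp size_poly.
rewrite !big_ord_recr big_ord0/= !coef_map/=.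
by rewrite -[RHS]px expr0 expr1; ring.
Qed.

Lemma int_quadratic_root_ex (R : realType) (A B C : int) : A != 0 ->
  exists p : {poly int}, forall x : R,
    A%:~R * x ^+ 2 + B%:~R * x + C%:~R = 0 -> int_quadratic_root p x.
Proof.
move=> A0; exists (Poly [:: C; B; A]) => x hx; apply/int_quadratic_rootE.
by split; [rewrite (@PolyK _ 0)|rewrite !coef_Poly].
Qed.

(** Vieta's relations for the roots x and y of A t^2 - B t + C, together with the
    discriminant D. The coefficient C is hidden because A, B and D determine
    the pair (integral_pair_inj). *)
Definition integral_pair (R : realType) (D : R) (A B : int) (x y : R) : Prop :=
  [/\ A != 0, A%:~R * (x + y) = B%:~R,
      exists C : int, A%:~R * (x * y) = C%:~R
    & (A%:~R * (x - y)) ^+ 2 = D].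

(** Two integral quadratics with a common irrational root are proportional:
    eliminating the square leaves an integral linear relation, which vanishes. *)
Lemma conjugateE (R : realType) (D x y : R) (A B : int) :
  irrational x -> integral_pair D A B x y -> y <> x ->
  quadratic_surd x /\ conjugate x = y.
Proof.
move=> xI [A0 AB [C AC] _] yx.
have [p hp] := @int_quadratic_root_ex R A (- B) C A0.
have px : int_quadratic_root p x by apply: hp; rewrite mulrNz -AB -AC; ring.
have py : int_quadratic_root p y by apply: hp; rewrite mulrNz -AB -AC; ring.
split; first by split=> //; exists p.
apply: xget_unique; first by split=> //; exists p.
move=> z [zx [q [/int_quadratic_rootE[sq qx] /int_quadratic_rootE[_ qz]]]].
have q0 : (q`_2)%:~R != 0 :> R.
  by rewrite intr_eq0 -[2%N]/3.-1 -sq lead_coef_eq0 -size_poly_eq0 sq.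
have AR : A%:~R != 0 :> R by rewrite intr_eq0.
have zE : (q`_2)%:~R * (x + z) = - (q`_1)%:~R.
  by apply: (mulfI (_ : x - z != 0)); [rewrite subr_eq0; apply/eqP/nesym|lra].
have /irrationalP/(_ (- q`_2 * B - A * q`_1) (C * q`_2 - A * q`_0)) := xI.
have -> : (- q`_2 * B - A * q`_1)%:~R * x + (C * q`_2 - A * q`_0)%:~R
   = 0 :> R.
  rewrite !(intrD, intrM, mulrNz) -AB -AC -[RHS](mulr0 (- A%:~R)) -qx; ring.
move=> /(_ erefl)/(congr1 (fun n : int => n%:~R : R)).
rewrite !(intrD, intrM, mulrNz) mulr0z -AB => e.
have e2 : (A%:~R * (q`_2)%:~R) * (y - z) = 0 :> R.
  by have := congr1 (fun t => A%:~R * t) zE; move: e; lra.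
by move/eqP: e2; rewrite mulf_eq0 mulf_eq0 (negbTE AR) (negbTE q0)/= subr_eq0 => /eqP.
Qed.

Lemma quadratic_surd_conj (R : realType) (x : R) : quadratic_surd x ->
  exists (D : R) (A B : int), integral_pair D A B x (conjugate x).
Proof.
move=> [xI [p px]].
have /int_quadratic_rootE[sp pxE] := px.
have p0 : p`_2 != 0.
  by rewrite -[2%N]/3.-1 -sp lead_coef_eq0 -size_poly_eq0 sp.
have pR : (p`_2)%:~R != 0 :> R by rewrite intr_eq0.
pose y : R := - (p`_1)%:~R / (p`_2)%:~R - x.
have xy : (p`_2)%:~R * (x + y) = (- p`_1)%:~R :> R.
  by rewrite /y mulrNz; field.
have yp : integral_pair (((p`_2)%:~R * (x - y)) ^+ 2) p`_2 (- p`_1) x y.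
  split=> //; exists p`_0; move: xy pxE; rewrite mulrNz; nra.
have yx : y <> x.
  move=> yx; have /irrationalP/(_ (p`_2 + p`_2) p`_1) := xI.
  have -> : (p`_2 + p`_2)%:~R * x + (p`_1)%:~R = 0 :> R.
    by rewrite intrD; move: xy; rewrite yx mulrNz; lra.
  by move=> /(_ erefl); move: p0; lia.
have [_ cE] := conjugateE xI yp yx.
by rewrite cE; do 3 eexists; exact: yp.
Qed.

(** If y = - golden R, subtracting the equations of x and of golden R leaves an
    integral linear relation for x; it forces x = golden R - 1, which is less
    than 1. *)
Lemma conj_neq_Ngolden (R : realType) (D x y : R) (A B : int) :
  1 < x -> irrational x -> integral_pair D A B x y -> y <> - golden R.
Proof.
move=> x1 xI [A0 + [C +] _] yG; rewrite {}yG => AB AC.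
have [G2 /andP[_ Glt2]] := golden_spec R.
have AR : A%:~R != 0 :> R by rewrite intr_eq0.
have /irrationalP/(_ (- (A * (B + A))) (B * B + A * B - A * A - A * C)) := xI.
have -> : (- (A * (B + A)))%:~R * x +
    (B * B + A * B - A * A - A * C)%:~R = 0 :> R.
  rewrite !(intrD, intrM, mulrNz) -AC -AB.
  have := congr1 (fun t => A%:~R * A%:~R * t) G2; nra.
move=> /(_ erefl)/eqP; rewrite oppr_eq0 mulf_eq0 (negbTE A0)/= => /eqP BA.
have : A%:~R * (x - golden R + 1) = 0.
  have : (B + A)%:~R = 0 :> R by rewrite BA.
  by rewrite intrD -AB => <-; ring.
by move=> /eqP; rewrite mulf_eq0 (negbTE AR)/= => /eqP; lra.
Qed.

Lemma integral_pair_inj (R : realType) (D x y x' y' : R) (A B : int) :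
  y < x -> y' < x' -> integral_pair D A B x y -> integral_pair D A B x' y' ->
  x = x' /\ y = y'.
Proof.
move=> xy xy' [A0 s _ d] [_ s' _ d'].
have AR : A%:~R != 0 :> R by rewrite intr_eq0.
have {s'}s : x + y = x' + y' by apply: (mulfI AR); rewrite s s'.
have {d'}d : (x - y) ^+ 2 = (x' - y') ^+ 2.
  have A2 : A%:~R ^+ 2 != 0 :> R by rewrite expf_neq0.
  by apply: (mulfI A2); rewrite -!exprMn d d'.
have : x - y = x' - y' by apply/eqP; rewrite -(@eqrXn2 _ 2%N) ?d // subr_ge0 ltW.
by split; lra.
Qed.

(** The step substitutes t = a + e / t' in the integral equation, and this
    substitution has determinant 1 or -1, so the discriminant is unchanged. *)
Lemma integral_pair_gauss (R : realType) (d : digit) (D x y : R) (A B : int) :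
  admissible d -> x != d.1%:R -> y != d.1%:R -> integral_pair D A B x y ->
  exists A' B' : int, integral_pair D A' B' (gauss d x) (gauss d y).
Proof.
move=> ad xa ya [A0 AB [C AC] <-]; have e2 := sign_sqr R ad; rewrite /gauss.
rewrite -[d.1%:R]/(d.1%:Z%:~R) in xa ya *.
move: (d.1%:Z) xa ya => a xa ya; set e : R := d.2%:~R in e2 *.
have {}xa : x - a%:~R != 0 by rewrite subr_eq0.
have {}ya : y - a%:~R != 0 by rewrite subr_eq0.
have AR : A%:~R != 0 :> R by rewrite intr_eq0.
(* A' = A (x - a) (y - a) is the old equation evaluated at a. *)
pose A' := A * a * a - B * a + C.
have A'E : A'%:~R = A%:~R * (x - a%:~R) * (y - a%:~R) :> R.
  by rewrite /A' !(intrD, intrM, mulrNz) -AB -AC; ring.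
exists A', (d.2 * (B - A * a - A * a)); split.
- by rewrite -(intr_eq0 R) A'E !mulf_neq0.
- by rewrite A'E !(intrD, intrM, mulrNz) -AB -/e; field; rewrite xa ya.
- exists A; rewrite A'E; transitivity (A%:~R * e ^+ 2); last by rewrite e2 mulr1.
  by field; rewrite xa ya.
- rewrite A'E; transitivity ((A%:~R * (x - y)) ^+ 2 * e ^+ 2).
    by field; rewrite xa ya.
  by rewrite e2 mulr1.
Qed.

(** * Convergence of both kinds of continued fractions *)

(** A single step need not contract (for the digit (1, 1), its derivative
    at 0 is -1, and for grotesque fractions it is even larger in absolute value
    near G - 2, where G is the golden ratio), hence the hypothesis on two
    consecutive steps. The truncations and the exact tails are two families
    related by the same steps in a bounded set I, so their distance decays
    geometrically. *)
Lemma nested_cvg (R : realType) (I : set R) (f : nat -> R -> R)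
    (t : nat -> nat -> R) (z : nat -> R) :
  (forall i n, I (t i n)) -> (forall i, I (z i)) ->
  (forall u v, I u -> I v -> `|u - v| <= 2) ->
  (forall i u v, I u -> I v ->
     `|f i (f i.+1 u) - f i (f i.+1 v)| <= 4 / 9 * `|u - v|) ->
  (forall i n, t i n.+1 = f i (t i.+1 n)) -> (forall i, z i = f i (z i.+1)) ->
  t 0%N n @[n --> \oo] --> z 0%N.
Proof.
move=> It Iz I2 fc tS zS.
(* The diameter 2 of I bounds the first two distances, as 4 * (2 / 3) >= 2. *)
have bound n : (forall i, `|t i n - z i| <= 4 * (2 / 3) ^+ n) /\
               (forall i, `|t i n.+1 - z i| <= 4 * (2 / 3) ^+ n.+1).
  elim: n => [|n [IH IH1]].
    split=> i; rewrite ?expr0 ?expr1.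
      by have := I2 _ _ (It i 0%N) (Iz i); lra.
    by have := I2 _ _ (It i 1%N) (Iz i); lra.
  split=> // i; rewrite tS tS zS zS (le_trans (fc _ _ _ _ _)) //.
  by have := IH i.+2; rewrite !exprS; lra.
have g0 : 4 * (2 / 3) ^+ n @[n --> \oo] --> (0 : R).
  apply: (@cvg_geometric _ 4 (2 / 3)).
  by rewrite ltr_norml; apply/andP; split; lra.
apply: (squeeze_cvgr (f := fun n => z 0%N - 4 * (2 / 3) ^+ n)
  (h := fun n => z 0%N + 4 * (2 / 3) ^+ n)).
- near=> n; have [/(_ 0%N) + _] := bound n.
  by rewrite ler_norml => /andP[? ?]; apply/andP; split; lra.
- rewrite -[X in _ --> X]subr0; apply: cvgB => //; exact: cvg_cst.
- rewrite -[X in _ --> X]addr0; apply: cvgD => //; exact: cvg_cst.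
Unshelve. all: by end_near. Qed.

(** The common form of two consecutive steps, for ordinary and for grotesque
    fractions: after the inner denominator is called p, the composite is
    p / (a p + e), up to a sign. *)
Lemma mobius_contraction (R : realType) (a e p q : R) :
  e ^+ 2 = 1 -> 3 / 2 <= a * p + e -> 3 / 2 <= a * q + e ->
  `|p / (a * p + e) - q / (a * q + e)| <= 4 / 9 * `|p - q|.
Proof.
move=> e2 hp hq; set m := a * p + e in hp *; set n := a * q + e in hq *.
have m0 : m != 0 by rewrite gt_eqF //; lra.
have n0 : n != 0 by rewrite gt_eqF //; lra.
have -> : p / m - q / n = e * (p - q) / (m * n).
  have -> : p / m - q / n = (p * n - q * m) / (m * n) by field; rewrite m0 n0.
  by congr (_ / _); rewrite /m /n; ring.
have mn : 9 / 4 <= m * n by nra.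
rewrite normrM normfV (ger0_norm (_ : 0 <= m * n)); last by lra.
rewrite ler_pdivrMr; last by lra.
have -> : `|e * (p - q)| = `|p - q|.
  by apply/eqP; rewrite -(@eqrXn2 _ 2%N) // -normrX exprMn e2 mul1r normrX.
by have := normr_ge0 (p - q); nra.
Qed.

Lemma iter_digits_tail (d : nat -> digit) (i j : nat) :
  iter i digits_tail d j = d (i + j)%N.
Proof. by elim: i j => // i IH j; rewrite iterS /digits_tail IH addSnnS. Qed.

Lemma ocf_denominator_bounds (R : realType) (d : digit) (u : R) :
  admissible d -> 0 <= u <= 1 ->
  1 <= d.1%:R + d.2%:~R * u <= d.1%:R + 1.
Proof.
move=> /(admissible_cases R)[[-> ->]|[a3 [->|->]]] /andP[u0 u1];
  by apply/andP; split; lra.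
Qed.

Lemma ocf_trunc_itv (R : realType) (d : nat -> digit) (n : nat) :
  (forall i, admissible (d i)) -> 0 <= ocf_trunc R d n <= 1.
Proof.
elim: n d => [|n IH] d ad /=; first by apply/andP; split; lra.
have /andP[h _] := ocf_denominator_bounds (ad 0%N) (IH (digits_tail d) (fun i => ad i.+1)).
by rewrite div1r invr_ge0 invf_le1; [apply/andP; split; lra|lra].
Qed.

Lemma ocf_expansion_of_chain (R : realType) (d : nat -> digit) (x : nat -> R) :
  (forall i, admissible (d i)) -> (forall i, 1 <= x i) ->
  (forall i, x i * x i.+1 = (d i).1%:R * x i.+1 + (d i).2%:~R) ->
  ocf_expansion (x 0%N) d.
Proof.
move=> ad x1 xS; split=> //.
have xn0 i : x i != 0 by rewrite gt_eqF // (lt_le_trans _ (x1 i)).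
have -> : x 0%N = (d 0%N).1%:R + (d 0%N).2%:~R * (x 1%N)^-1.
  by apply: (mulIf (xn0 1%N)); rewrite xS; field.
apply: cvgD; first exact: cvg_cst.
apply: cvgMr.
apply: (@nested_cvg R [set u | 0 <= u <= 1]
  (fun i u => 1 / ((d i.+1).1%:R + (d i.+1).2%:~R * u))
  (fun i n => ocf_trunc R (iter i.+1 digits_tail d) n) (fun i => (x i.+1)^-1)).
- by move=> i n; apply: ocf_trunc_itv => j; rewrite iter_digits_tail.
- by move=> i /=; rewrite invr_ge0 invf_le1 ?x1 ?andbT; have := x1 i.+1; lra.
- by move=> u v /= /andP[? ?] /andP[? ?]; rewrite ler_norml; apply/andP; split; lra.
- move=> i u v /= hu hv.
  have [a1 ae _] := admissible_bounds R (ad i.+1).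
  have [_ _ e'1] := admissible_bounds R (ad i.+2).
  have /andP[pu _] := ocf_denominator_bounds (ad i.+2) hu.
  have /andP[pv _] := ocf_denominator_bounds (ad i.+2) hv.
  (* p is the inner denominator; a p + e >= 2 because p >= 1 and a + e >= 2. *)
  have key (a e p : R) : 1 <= a -> 2 <= a + e -> 1 <= p ->
      3 / 2 <= a * p + e /\ 1 / (a + e * (1 / p)) = p / (a * p + e).
    move=> ? ? ?; have h : 3 / 2 <= a * p + e by nra.
    split=> //; field; apply/andP; split; rewrite gt_eqF //; lra.
  have [hu1 ->] := key _ _ _ a1 ae pu; have [hv1 ->] := key _ _ _ a1 ae pv.
  rewrite (le_trans (mobius_contraction (sign_sqr R (ad i.+1)) hu1 hv1)) //.
  rewrite opprD addrACA subrr add0r -mulrBr.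
  by rewrite normrM; case: e'1 => ->; rewrite ?normrN normr1; lra.
- move=> i n; have -> // : d i.+1 = iter i.+1 digits_tail d 0%N.
  by rewrite iter_digits_tail addn0.
- move=> i /=; rewrite div1r; congr (_^-1).
  by apply: (mulIf (xn0 i.+2)); rewrite xS; field.
Qed.

(** G - 1 = 1 / G and G + 1 = 1 / (2 - G): the digit (1, 1) has its images in
    [2 - G, G], and every other admissible digit has them in absolute value at
    most 2 - G. *)
Lemma golden_itv_step (R : realType) (d : digit) (u : R) :
  admissible d -> golden R - 2 <= u <= golden R ->
  golden R - 1 <= d.1%:R + u /\
  golden R - 2 <= d.2%:~R / (d.1%:R + u) <= golden R.
Proof.
move=> ad /andP[u1 u2]; have [G2 /andP[Gg Gl]] := golden_spec R.
have h : golden R - 1 <= d.1%:R + u.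
  by have [? _ _] := admissible_bounds R ad; lra.
split=> //; rewrite ler_pdivlMr ?ler_pdivrMr; try lra.
by case: (admissible_cases R ad) h => [[-> ->]|[a3 [->|->]]] h;
  apply/andP; split; nra.
Qed.

Lemma gcf_trunc_itv (R : realType) (d : nat -> digit) (n : nat) :
  (forall i, admissible (d i)) -> golden R - 2 <= gcf_trunc R d n <= golden R.
Proof.
elim: n d => [|n IH] d ad /=.
  by have [_ /andP[? ?]] := golden_spec R; apply/andP; split; lra.
exact: (golden_itv_step (ad 0%N) (IH (digits_tail d) (fun i => ad i.+1))).2.
Qed.

Lemma gcf_expansion_of_chain (R : realType) (d : nat -> digit) (u : nat -> R) :
  (forall i, admissible (d i)) ->
  (forall i, golden R - 2 <= u i <= golden R) ->
  (forall i, u i = (d i).2%:~R / ((d i).1%:R + u i.+1)) ->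
  gcf_expansion (u 0%N) d.
Proof.
move=> ad uJ uS; split=> //; have [_ /andP[Gg Gl]] := golden_spec R.
apply: (@nested_cvg R [set v | golden R - 2 <= v <= golden R]
  (fun i v => (d i).2%:~R / ((d i).1%:R + v))
  (fun i n => gcf_trunc R (iter i digits_tail d) n) u) => //.
- by move=> i n; apply: gcf_trunc_itv => j; rewrite iter_digits_tail.
- by move=> v w /= /andP[? ?] /andP[? ?]; rewrite ler_norml; apply/andP; split; lra.
- move=> i v w /= hv hw.
  have [a1 _ e1] := admissible_bounds R (ad i).
  have [_ be _] := admissible_bounds R (ad i.+1).
  have [pv _] := golden_itv_step (ad i.+1) hv.
  have [pw _] := golden_itv_step (ad i.+1) hw.
  (* a (b + y) + e' >= b + e' + y >= golden R, which exceeds 3 / 2. *)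
  have key (a e b e' y : R) : 1 <= a -> 2 <= b + e' -> golden R - 2 <= y ->
      golden R - 1 <= b + y -> 3 / 2 <= a * (b + y) + e' /\
      e / (a + e' / (b + y)) = e * ((b + y) / (a * (b + y) + e')).
    move=> ? ? ? ?; have h : 3 / 2 <= a * (b + y) + e' by nra.
    split=> //; field; apply/andP; split; rewrite gt_eqF //; lra.
  case/andP: hv => hv _; case/andP: hw => hw _.
  have [hv1 ->] := key _ (d i).2%:~R _ _ _ a1 be hv pv.
  have [hw1 ->] := key _ (d i).2%:~R _ _ _ a1 be hw pw.
  rewrite -mulrBr normrM.
  have -> : `|(d i).2%:~R : R| = 1 by case: e1 => ->; rewrite ?normrN normr1.
  rewrite mul1r (le_trans (mobius_contraction (sign_sqr R (ad i.+1)) hv1 hw1)) //.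
  by rewrite opprD addrACA subrr add0r.
- move=> i n; have -> // : d i = iter i digits_tail d 0%N.
  by rewrite iter_digits_tail addn0.
Qed.

(** * Chains of complete quotients *)

Lemma golden_conj_step (R : realType) (d : digit) (y : R) :
  admissible d -> - golden R <= y <= 2 - golden R ->
  y != d.1%:R /\ - golden R <= gauss d y <= 2 - golden R.
Proof.
move=> ad /andP[y1 y2]; have [_ /andP[Gg Gl]] := golden_spec R.
have [|h /andP[h1 h2]] := @golden_itv_step R d (- y) ad.
  by apply/andP; split; lra.
have yd : y - d.1%:R < 0 by lra.
split; first by rewrite -subr_eq0 lt_eqF.
rewrite /gauss; have -> : y - d.1%:R = - (d.1%:R - y) by ring.
by rewrite invrN mulrN; apply/andP; split; lra.
Qed.

(** A convergent expansion can be peeled one digit at a time: the truncations of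
    the tail are recovered from those of x, and they stay away from 0, so their
    inverses converge to the next complete quotient. *)
Lemma ocf_expansion_tail (R : realType) (d : nat -> digit) (x : R) :
  ocf_expansion x d ->
  1 < x /\ ocf_expansion (gauss (d 0%N) x) (digits_tail d).
Proof.
have ge1 c y : ocf_expansion y c -> 1 <= y :> R.
  case=> ac /cvgr_to_ge; apply; apply: nearW => n.
  by have /andP[] := ocf_denominator_bounds (ac 0%N)
    (ocf_trunc_itv R n (fun i => ac i.+1)).
rewrite /gauss => -[ad]; set a : R := (d 0%N).1%:R; set e : R := (d 0%N).2%:~R => wx.
have e1 : e = 1 \/ e = -1 by have [] := admissible_bounds R (ad 0%N).
have e2 := sign_sqr R (ad 0%N); rewrite -/e in e2.
have tx : ocf_trunc R (digits_tail d) n.+1 @[n --> \oo] --> e * (x - a).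
  rewrite (cvg_shiftS (fun n => ocf_trunc R (digits_tail d) n)).
  have -> : ocf_trunc R (digits_tail d) =
      (fun n => e * (a + e * ocf_trunc R (digits_tail d) n - a)).
    by apply/funext => n; rewrite addrAC subrr add0r mulrA -expr2 e2 mul1r.
  by apply: cvgMr; apply: cvgB => //; exact: cvg_cst.
have bnd n := ocf_denominator_bounds (ad 1%N)
  (ocf_trunc_itv R n (fun i => ad i.+2)).
have a1 : 1 <= (d 1%N).1%:R :> R by have [] := admissible_bounds R (ad 1%N).
(* e (x - a) is the limit of numbers that are at least 1 / (a_1 + 1). *)
have z0 : 0 < e * (x - a).
  apply: (@lt_le_trans _ _ ((d 1%N).1%:R + 1)^-1); first by rewrite invr_gt0; lra.
  apply: (cvgr_to_ge tx); apply: nearW => n /=; rewrite div1r.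
  by have /andP[? ?] := bnd n; rewrite lef_pV2 // posrE; lra.
have xa : x - a != 0 by apply: contraTneq z0 => ->; rewrite mulr0 ltxx.
have tailx : ocf_expansion (e / (x - a)) (digits_tail d).
  split; first by move=> i; exact: ad.
  have -> : e / (x - a) = (e * (x - a))^-1.
    by rewrite invfM; case: e1 => ->; rewrite ?invrN invr1.
  have tE n : (ocf_trunc R (digits_tail d) n.+1)^-1 = (d 1%N).1%:R +
      (d 1%N).2%:~R * ocf_trunc R (digits_tail (digits_tail d)) n.
    by rewrite /= div1r invrK.
  have := @cvgV R nat \oo _ _ _ (lt0r_neq0 z0) tx; rewrite (eq_cvg _ _ tE).
  exact.
split=> //; have x'1 := ge1 _ _ tailx.
have -> : x = a + e / (e / (x - a)).
  rewrite invf_div mulrCA mulfV ?mulr1; first by rewrite addrC subrK.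
  by apply: contraTneq z0 => ->; rewrite mul0r ltxx.
have h : 0 < (e / (x - a))^-1 <= 1 by rewrite invr_gt0 invf_le1; lra.
case: (admissible_cases R (ad 0%N)) h; rewrite -/a -/e.
  by move=> [-> ->] /andP[? ?]; lra.
by move=> [a3 [->|->]] /andP[? ?]; lra.
Qed.

Fixpoint complete_quotient (R : realType) (d : nat -> digit) (x : R) (i : nat) : R :=
  if i is j.+1 then gauss (d j) (complete_quotient d x j)
  else x.

Lemma complete_quotientS (R : realType) (d : nat -> digit) (x : R) i :
  complete_quotient d x i != (d i).1%:R ->
  complete_quotient d x i * complete_quotient d x i.+1 =
    (d i).1%:R * complete_quotient d x i.+1 + (d i).2%:~R.
Proof. exact: gauss_rel. Qed.

Lemma ocf_expansion_complete_quotient (R : realType) (d : nat -> digit) (x : R) i :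
  ocf_expansion x d ->
  ocf_expansion (complete_quotient d x i) (iter i digits_tail d).
Proof.
move=> xd; elim: i => // i /ocf_expansion_tail[_].
by rewrite iter_digits_tail addn0.
Qed.

Lemma ocf_expansion_neq (R : realType) (d : nat -> digit) (x : R) i :
  ocf_expansion x d -> complete_quotient d x i != (d i).1%:R.
Proof.
move=> xd; apply/eqP => h.
have [+ _] := ocf_expansion_tail (ocf_expansion_complete_quotient i.+1 xd).
by rewrite /= /gauss h subrr invr0 mulr0; lra.
Qed.

Lemma golden_complete_quotient (R : realType) (d : nat -> digit) (y : R) i :
  (forall i, admissible (d i)) -> - golden R <= y <= 2 - golden R ->
  - golden R <= complete_quotient d y i <= 2 - golden R.
Proof.
by move=> ad hy; elim: i => // i /(golden_conj_step (ad i))[].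
Qed.

(** Descent on the denominator: if p x + q = 0, then the next complete quotient
    x' > 1 satisfies (p a + q) x' + p e = 0, and |p a + q| = |p| / x' < |p|. *)
Lemma ocf_irrational (R : realType) (d : nat -> digit) (x : R) :
  ocf_expansion x d -> irrational x.
Proof.
move=> xd; apply/irrationalP => p q.
have [n] := ubnP `|p|%N; elim: n p q x d xd => // n IH p q x d xd pn pq.
apply/eqP; apply: contraT => p0.
have [x1 x'd] := ocf_expansion_tail xd; have [x'1 _] := ocf_expansion_tail x'd.
have xa := ocf_expansion_neq 0 xd; have := complete_quotientS xa.
rewrite /= in xa *; set x' := gauss _ _ in x'd x'1 * => xx'.
clearbody x'.
pose a := (d 0%N).1%:Z; pose e := (d 0%N).2.
have [ad _] := xd.
have e1 := sign_sqr R (ad 0%N).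
have rel : (p * a + q)%:~R * x' + (p * e)%:~R = 0 :> R.
  have -> : (p * a + q)%:~R * x' + (p * e)%:~R =
    (p%:~R * x + q%:~R) * x' + p%:~R * (a%:~R * x' + e%:~R - x * x').
    by rewrite !(intrD, intrM); ring.
  by rewrite pq xx' subrr mulr0 mul0r addr0.
have /(IH _ _ _ _ x'd)/(_ rel) pa0 : (`|(p * a + q)%R| < n)%N.
  suff : (`|(p * a + q)%R| < `|p|)%N by lia.
  have pR : 0 < `|p%:~R : R| by rewrite normr_gt0 intr_eq0.
  have : `|(p * a + q)%:~R| * x' = `|p%:~R : R|.
    apply/eqP; rewrite -(@eqrXn2 _ 2%N) ?mulr_ge0 //; last by lra.
    rewrite exprMn -!normrX -{1}(@ger0_norm _ (x' ^+ 2)) ?sqr_ge0 //.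
    rewrite -normrM -exprMn.
    have -> : (p * a + q)%:~R * x' = - (p * e)%:~R.
      by apply/eqP; rewrite -addr_eq0 rel.
    by rewrite sqrrN intrM exprMn e1 mulr1.
  have h0 : 0 <= `|(p * a + q)%:~R : R| by [].
  move=> hE; have : `|(p * a + q)%:~R : R| < `|p%:~R : R| by nra.
  by rewrite -!intr_norm ltr_int; lia.
move: rel; rewrite pa0 mul0r add0r => /eqP; rewrite intr_eq0 mulf_eq0 (negbTE p0).
by move=> /eqP e0; move: e1; rewrite -/e e0 expr0n /= => /eqP; rewrite eq_sym oner_eq0.
Qed.

(** The matrix is the product of those of the digits. Multiplication on the left
    by the matrix of a first digit preserves 0 < C <= A; on the right this would
    not be visible, hence the induction on the tail. The relation is stated
    for all chains, since it serves both for x and for points of the interval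
    of its conjugate. *)
Lemma convergent_matrix (R : realType) (d : nat -> digit) (n : nat) :
  (forall i, admissible (d i)) -> exists A B C D : int,
    0 < C <= A /\
    forall x : nat -> R,
      (forall i, x i * x i.+1 = (d i).1%:R * x i.+1 + (d i).2%:~R) ->
      (C%:~R * x n.+1 + D%:~R) * x 0%N = A%:~R * x n.+1 + B%:~R.
Proof.
elim: n d => [|n IH] d ad.
  exists (d 0%N).1, (d 0%N).2, 1, 0; split; last by move=> x /(_ 0%N) <-; ring.
  by case: (d 0%N) (ad 0%N) => a e /= /and3P[/=]; lia.
have [A [B [C [D [CA ABCD]]]]] := IH (digits_tail d) (fun i => ad i.+1).
case d0 : (d 0%N) (ad 0%N) => [a e] /and3P[/= oa ee ae].
exists (a%:Z * A + e * C), (a%:Z * B + e * D), A, B; split.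
  have a1 : (1 <= a)%N by lia.
  case/orP: ee ae => /eqP -> ae; first by nia.
  by have : (3 <= a)%N; [lia|nia].
move=> x xS; have := ABCD (fun i => x i.+1) (fun i => xS i.+1).
have := xS 0%N; rewrite d0 /= !(intrD, intrM) => h0 h.
rewrite -h -mulrA [x 1%N * _]mulrC h0 -[LHS]addr0.
transitivity (a%:R * ((C%:~R * x n.+2 + D%:~R) * x 1%N)
   + e%:~R * (C%:~R * x n.+2 + D%:~R)); first by ring.
by rewrite h -[a%:R]/(a%:Z%:~R); ring.
Qed.

(** * Purely periodic expansions have reduced conjugates *)

Lemma iter_digits_tail_period (s : seq digit) :
  iter (size s) digits_tail (periodic_digits s) = periodic_digits s.
Proof.
by apply/funext => j; rewrite iter_digits_tail /periodic_digits modnDl.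
Qed.

Lemma admissible_rev (s : seq digit) : s != [::] ->
  (forall i, admissible (periodic_digits s i)) ->
  forall i, admissible (periodic_digits (rev s) i).
Proof.
rewrite -size_eq0 -lt0n => s0 ad i.
rewrite /periodic_digits size_rev nth_rev ?ltn_mod //.
have lt : (size s - (i %% size s).+1 < size s)%N by rewrite ltn_subrL s0.
by have := ad (size s - (i %% size s).+1)%N; rewrite /periodic_digits modn_small.
Qed.

(** Read backwards and negated, the cycle of complete quotients of y is a cycle
    of tails of a grotesque fraction. *)
Lemma gcf_expansion_rev (R : realType) (s : seq digit) (y : R) : s != [::] ->
  (forall i, admissible (periodic_digits s i)) ->
  - golden R <= y <= 2 - golden R ->
  complete_quotient (periodic_digits s) y (size s) = y ->
  gcf_expansion (- y) (periodic_digits (rev s)).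
Proof.
move=> s0 ad hy yr; set d := periodic_digits s in ad yr.
set Q := complete_quotient d y in yr *; set r := size s in yr *.
have r0 : (0 < r)%N by rewrite lt0n size_eq0.
have hQ i : - golden R <= Q i <= 2 - golden R.
  exact: golden_complete_quotient.
have := @gcf_expansion_of_chain R (periodic_digits (rev s))
  (fun k => - Q (r - k %% r)%N) (admissible_rev s0 ad).
rewrite mod0n subn0 yr; apply => k.
  by have /andP[? ?] := hQ (r - k %% r)%N; apply/andP; split; lra.
set j := (k %% r)%N; have jr : (j < r)%N by rewrite ltn_mod.
have -> : periodic_digits (rev s) k = d (r - j.+1)%N.
  rewrite /d /periodic_digits size_rev nth_rev ?ltn_mod //.
  by rewrite -/r (@modn_small (r - _)%N) // ltn_subrL r0.
(* At the end of a period, k.+1 %% r is 0 instead of r; both give the value y. *)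
have -> : Q (r - k.+1 %% r)%N = Q (r - j.+1)%N.
  rewrite -addn1 -modnDml -/j addn1.
  have [lt|ge] := ltnP j.+1 r; first by rewrite modn_small.
  by have -> : j.+1 = r by [lia|]; rewrite modnn subn0 subnn yr.
have -> : (r - j = (r - j.+1).+1)%N by lia.
rewrite {1}/Q /= -/Q /gauss -mulrN -invrN; congr (_ / _); ring.
Qed.

Lemma periodic_expansion_conjugate (R : realType) (s : seq digit) (x : R) :
  s != [::] -> ocf_expansion x (periodic_digits s) ->
  [/\ quadratic_surd x, - golden R < conjugate x <= 2 - golden R
    & gcf_expansion (- conjugate x) (periodic_digits (rev s))].
Proof.
move=> s0 xd; set d := periodic_digits s in xd; have [ad _] := xd.
have [G2 /andP[Gg Gl]] := golden_spec R.
have [n rn] : exists n, size s = n.+1 by case: (s) s0 => // c s' _; exists (size s').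
have [x1 _] := ocf_expansion_tail xd; have xI := ocf_irrational xd.
have xr : complete_quotient d x n.+1 = x.
  have := ocf_expansion_complete_quotient n.+1 xd.
  rewrite -{2}rn iter_digits_tail_period => -[_ h].
  have [_ h'] := xd; exact: (cvg_unique (@Rhausdorff R) h h').
(* Removing the block fixes x, which is thus a root of C t^2 + (D - A) t - B. *)
have [A [B [C [D [/andP[C0 CA] ABCD]]]]] := convergent_matrix R n ad.
have C0R : 0 < C%:~R :> R by rewrite ltr0z.
have CAR : C%:~R <= A%:~R :> R by rewrite ler_int.
have CN : C%:~R != 0 :> R by rewrite gt_eqF.
have Px : (C%:~R * x + D%:~R) * x = A%:~R * x + B%:~R.
  have := ABCD (complete_quotient d x)
    (fun i => complete_quotientS (ocf_expansion_neq i xd)).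
  by rewrite xr.
(* The other root of the same quadratic, by Vieta. *)
pose y : R := (A - D)%:~R / C%:~R - x.
have CAD : (A - D)%:~R = C%:~R * (x + y) by rewrite /y; field.
(* The quadratic at t measures how far removing the block moves t, so its sign
   is known at the ends of an interval that is mapped into itself. *)
have defect t : - golden R <= t <= 2 - golden R ->
    C%:~R * ((t - x) * (t - y)) =
    (complete_quotient d t n.+1 - t) * (A%:~R - C%:~R * t) /\
    0 < A%:~R - C%:~R * t.
  move=> ht; have hQ i := golden_complete_quotient i ad ht.
  split; last by case/andP: ht => _ ?; nra.
  have := ABCD (complete_quotient d t)
    (fun i => complete_quotientS (golden_conj_step (ad i) (hQ i)).1).
  by move: CAD Px; rewrite /= intrD mulrNz; nra.
have hy : - golden R <= y <= 2 - golden R.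
  have itvl : - golden R <= - golden R <= 2 - golden R by apply/andP; split; lra.
  have itvr : - golden R <= 2 - golden R <= 2 - golden R by apply/andP; split; lra.
  have [defl Al] := defect _ itvl; have [defr Ar] := defect _ itvr.
  have /andP[ql _] := golden_complete_quotient n.+1 ad itvl.
  have /andP[_ qr] := golden_complete_quotient n.+1 ad itvr.
  have Pl : 0 <= (- golden R - x) * (- golden R - y).
    by rewrite -(pmulr_rge0 _ C0R) defl mulr_ge0 //; lra.
  have Pr : (2 - golden R - x) * (2 - golden R - y) <= 0.
    by rewrite -(pmulr_rle0 _ C0R) defr mulr_le0_ge0 //; lra.
  by apply/andP; split; nra.
(* The quadratic vanishes at y, so removing the block does not move y. *)
have yr : complete_quotient d y n.+1 = y.
  have [+ Ay] := defect _ hy; rewrite subrr !mulr0 => /esym/eqP.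
  by rewrite mulf_eq0 (gt_eqF Ay) orbF subr_eq0 => /eqP.
have xyp : integral_pair ((C%:~R * (x - y)) ^+ 2) C (A - D) x y.
  split=> //; first by rewrite gt_eqF.
  exists (- B); rewrite mulrNz; move: Px CAD; rewrite intrD mulrNz; nra.
have yx : y <> x by move=> e; move: hy; rewrite e => /andP[? ?]; lra.
have [xQ ->] := conjugateE xI xyp yx.
split=> //; last by apply: gcf_expansion_rev; rewrite // rn.
have /eqP yG := conj_neq_Ngolden x1 xI xyp.
by case/andP: hy => yl ->; rewrite lt_neqAle eq_sym yG yl.
Qed.

(** * Reduced surds are purely periodic *)

(** The digit is the odd one among the floor and the ceiling of x. *)
Lemma gauss_digit (R : realType) (x : R) : 1 < x -> irrational x ->
  exists2 d : digit, admissible d & 1 < gauss d x.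
Proof.
move=> x1 xI; have /andP[fl fu] := floor_itv x.
have f1 : 1 <= Num.floor x by rewrite floor_ge_int ltW.
case: (Num.floor x) f1 fl fu => // n f1; rewrite intrD -[n%:~R]/(n%:R) => fl fu.
have n1 : (1 <= n)%N by lia.
have xn : x <> n%:R := @irrational_neq_nat _ _ _ xI.
have {}fl : n%:R < x by rewrite lt_neqAle fl andbT eq_sym; apply/eqP.
case on : (odd n).
  exists (n, 1); first by rewrite /admissible /= on; lia.
  by rewrite /gauss /= div1r invf_gt1; lra.
exists (n.+1, -1); first by rewrite /admissible /= on; lia.
rewrite /gauss /= -opprB invrN mulrNz mulrNN div1r invf_gt1; rewrite -addn1 natrD; lra.
Qed.

(** The sign of the image gives e, and its inverse gives y - a, whose a is
    determined among odd integers because y lies in a half-open interval of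
    length 2. *)
Lemma gauss_conj_inj (R : realType) (d d' : digit) (y y' : R) :
  admissible d -> admissible d' ->
  - golden R < y <= 2 - golden R -> - golden R < y' <= 2 - golden R ->
  gauss d y = gauss d' y' -> d = d'.
Proof.
move=> ad ad' /andP[y1 y2] /andP[y'1 y'2]; have [_ /andP[Gg Gl]] := golden_spec R.
have [a1 _ e1] := admissible_bounds R ad.
have [a'1 _ e'1] := admissible_bounds R ad'.
have ya : y - d.1%:R < 0 by lra.
have y'a : y' - d'.1%:R < 0 by lra.
rewrite /gauss => /eqP; rewrite eqr_div ?(lt_eqF ya) ?(lt_eqF y'a) // => /eqP h.
have ee : d.2%:~R = d'.2%:~R :> R by case: e1 e'1 h => -> [] ->; lra.
apply: (digit_inj ad ad' ee); rewrite ltr_norml.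
have {h} : y - d.1%:R = y' - d'.1%:R by move: h; rewrite ee; case: e'1 => ->; lra.
by move=> h; apply/andP; split; lra.
Qed.

Definition reduced (R : realType) (D x y : R) : Prop :=
  [/\ 1 < x, irrational x, - golden R < y <= 2 - golden R
    & exists A B : int, integral_pair D A B x y].

Lemma reduced_gauss (R : realType) (D x y : R) : reduced D x y ->
  exists2 d : digit, admissible d & reduced D (gauss d x) (gauss d y).
Proof.
move=> [x1 xI /andP[yl yr] [A [B xyp]]].
have [d ad x'1] := gauss_digit x1 xI; exists d => //.
have [|ya /andP[y'l y'r]] := @golden_conj_step R d y ad.
  by apply/andP; split; lra.
have [A' [B' x'y'p]] : exists A' B' : int,
    integral_pair D A' B' (gauss d x) (gauss d y).
  apply: integral_pair_gauss xyp => //.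
  by apply/eqP/irrational_neq_nat.
have x'I := gauss_irrational ad xI.
split=> //; last by exists A', B'.
have /eqP yG := conj_neq_Ngolden x'1 x'I x'y'p.
by rewrite lt_neqAle eq_sym yG /=; apply/andP; split.
Qed.

(** Since x - y is bounded below, D = (A (x - y))^2 bounds A; then B = A (x + y)
    is bounded because y is. *)
Lemma reduced_bounded (R : realType) (D : R) : exists N : nat,
  forall (x y : R) (A B : int), 1 < x -> - golden R < y <= 2 - golden R ->
    integral_pair D A B x y -> (`|A| <= N%:Z) && (`|B| <= N%:Z).
Proof.
have [_ /andP[Ggt Glt]] := golden_spec R.
(* 5 + 17 D = (1 + D) + 4 (1 + 4 D), from the bounds on A (x - y) and on A. *)
exists (Num.bound (5 + 17 * D)) => x y A B x1 /andP[yG Gy] [A0 AB _ DE].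
have D0 : 0 <= D by rewrite -DE sqr_ge0.
have := archi_boundP (_ : 0 <= 5 + 17 * D); set N := Num.bound _.
move=> /(_ _)/ltW; rewrite -[N%:R]/(N%:Z%:~R) => hN.
have {}hN : 5 + 17 * D <= N%:Z%:~R by apply: hN; lra.
(* x - y >= golden R - 1 > 1 / 2, so A^2 <= 4 D. *)
have hA : `|A%:~R| <= 1 + 4 * D.
  have : 0 <= A%:~R ^+ 2 * ((x - y) ^+ 2 - 1 / 4).
    by apply: mulr_ge0; [exact: sqr_ge0|nra].
  by rewrite ler_norml => ?; apply/andP; split; nra.
have hB : `|B%:~R| <= 5 + 17 * D.
  have -> : B%:~R = A%:~R * (x - y) + 2 * (A%:~R * y) by rewrite -AB; ring.
  have := ler_normD (A%:~R * (x - y)) (2 * (A%:~R * y)).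
  have : `|A%:~R * (x - y)| <= 1 + D by rewrite ler_norml; apply/andP; split; nra.
  have : `|2 * (A%:~R * y)| <= 4 * `|A%:~R|.
    rewrite !normrM (ger0_norm (_ : 0 <= 2)) //.
    have : `|y| <= 2 by rewrite ler_norml; apply/andP; split; lra.
    by have := normr_ge0 (A%:~R : R); nra.
  by lra.
by rewrite -!(ler_int R) !intr_norm; apply/andP; split; lra.
Qed.

Lemma bounded_repeats (f : nat -> int * int) (N : nat) :
  (forall n, (`|(f n).1| <= N%:Z) && (`|(f n).2| <= N%:Z)) ->
  exists m n : nat, (m < n)%N /\ f m = f n.
Proof.
move=> fN; set K := #|{: 'I_(N + N).+1 * 'I_(N + N).+1}|.
pose code (z : int) : 'I_(N + N).+1 := inord `|(z + N%:Z)%R|%N.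
have code_inj z z' : `|z| <= N%:Z -> `|z'| <= N%:Z -> code z = code z' -> z = z'.
  by move=> hz hz' /(congr1 (@nat_of_ord _)); rewrite !inordK; lia.
pose g (i : 'I_K.+1) := (code (f i).1, code (f i).2).
have /injectivePn[i [j ij gij]] : ~~ injectiveb g.
  by apply/negP => /injectiveP/leq_card; rewrite card_ord ltnn.
have fij : f i = f j.
  have /andP[? ?] := fN i; have /andP[? ?] := fN j.
  case: gij => /code_inj e1 /code_inj e2.
  by rewrite [LHS]surjective_pairing [RHS]surjective_pairing e1 // e2.
have [lt|gt|/val_inj eq] := ltngtP (i : nat) j; last by rewrite eq eqxx in ij.
  by exists i, j.
by exists j, i.
Qed.

Lemma reduced_purely_periodic (R : realType) (D x y : R) :
  reduced D x y -> purely_periodic_ocf x.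
Proof.
move=> xyR; have [_ /andP[Gg Gl]] := golden_spec R.
have [dig digP] : {dig : R * R -> digit & forall z, reduced D z.1 z.2 ->
    admissible (dig z) /\ reduced D (gauss (dig z) z.1) (gauss (dig z) z.2)}.
  apply: (@choice _ _ (fun z d => reduced D z.1 z.2 ->
    admissible d /\ reduced D (gauss d z.1) (gauss d z.2))) => z.
  case: (pselect (reduced D z.1 z.2)) => [/reduced_gauss[d ? ?]|?].
    by exists d.
  by exists (1%N, 1).
pose next z := (gauss (dig z) z.1, gauss (dig z) z.2).
pose orb n := iter n next (x, y).
have orbR n : reduced D (orb n).1 (orb n).2.
  by elim: n => // n /digP[].
have ad n : admissible (dig (orb n)) by have [] := digP _ (orbR n).
(* The conjugates agree, so the digits agree, and then so do the preimages. *)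
have next_inj m n : orb m.+1 = orb n.+1 -> orb m = orb n.
  move=> [h1 h2]; have [_ _ hm _] := orbR m; have [_ _ hn _] := orbR n.
  have dd := gauss_conj_inj (ad m) (ad n) hm hn h2.
  move: h1 h2; rewrite -dd => /(gauss_inj (ad m)) h1 /(gauss_inj (ad m)) h2.
  by rewrite [LHS]surjective_pairing h1 h2 -surjective_pairing.
have [k k0 orbk] : exists2 k, (0 < k)%N & orb k = orb 0%N.
  have [N hN] := reduced_bounded D.
  have [AB hAB] : {AB : nat -> int * int &
      forall n, integral_pair D (AB n).1 (AB n).2 (orb n).1 (orb n).2}.
    apply: (@choice _ _ (fun n c =>
      integral_pair D c.1 c.2 (orb n).1 (orb n).2)) => n.
    by have [_ _ _ [A [B h]]] := orbR n; exists (A, B).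
  have [n|m [n [mn ABmn]]] := @bounded_repeats AB N.
    by have [h1 _ h2 _] := orbR n; exact: hN h1 h2 (hAB n).
  have : orb (n - m + m)%N = orb (0 + m)%N.
    rewrite subnK ?(ltnW mn) // add0n.
    have [m1 _ /andP[_ m2] _] := orbR m; have [n1 _ /andP[_ n2] _] := orbR n.
    have := hAB m; rewrite ABmn => hm.
    have [||e1 e2] := integral_pair_inj _ _ (hAB n) hm; [lra|lra|].
    by rewrite [LHS]surjective_pairing e1 e2 -surjective_pairing.
  exists (n - m)%N; first by rewrite subn_gt0.
  elim: m {mn ABmn} (n - m)%N H => [|m IH] k; first by rewrite addn0.
  by rewrite !addnS => /next_inj/IH.
have orb_mod n : orb (n %% k)%N = orb n.
  rewrite {2}(divn_eq n k); elim: (n %/ k)%N => // q IH.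
  rewrite mulSn -addnA addnC [orb (_ + k)%N]iterD -[iter k _ _]/(orb k) orbk.
  exact: IH.
exists (mkseq (fun i => dig (orb i)) k).
split; first by rewrite -size_eq0 size_mkseq -lt0n.
have -> : periodic_digits (mkseq (fun i => dig (orb i)) k) =
    (fun i => dig (orb i)).
  apply/funext => i.
  by rewrite /periodic_digits size_mkseq nth_mkseq ?ltn_mod // orb_mod.
apply: (@ocf_expansion_of_chain R _ (fun n => (orb n).1)) => // i.
  by have [/ltW] := orbR i.
have [_ /(@irrational_neq_nat _ _ (dig (orb i)).1)/eqP + _ _] := orbR i.
exact: gauss_rel.
Qed.

(* The upper bound is non-strict: with a strict one the equivalence fails for
   alpha = golden R + 1, purely periodic with block [:: (3, -1)] and with
   conjugate 2 - golden R; no other alpha > 1 has that conjugate. *)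
Theorem proposition5 (R : realType) (alpha : R) (alpha_gt1 : 1 < alpha) :
  (purely_periodic_ocf alpha <->
     quadratic_surd alpha /\
     - golden R < conjugate alpha <= 2 - golden R) /\
  (forall s : seq digit, s != [::] ->
     ocf_expansion alpha (periodic_digits s) ->
     gcf_expansion (- conjugate alpha) (periodic_digits (rev s))).
Proof.
split; last by move=> s s0 /(periodic_expansion_conjugate s0)[].
split=> [[s [s0 /(periodic_expansion_conjugate s0)[]]] //|[aQ conj_itv]].
have [D [A [B abp]]] := quadratic_surd_conj aQ.
by apply: (@reduced_purely_periodic R D _ (conjugate alpha)); split;
  [| exact: aQ.1 | | exists A, B].
Qed.
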